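(* Let $G$ be a finite simple graph and, for $X,Y\in\mathcal{X}(G)$ and $i\in V_G$, let $$B(X,Y)(i)=\tfrac12\langle X,(\Delta_{\tau G}-\nabla\operatorname{div})Y\rangle_{T_i(G)}+\tfrac12\langle Y,(\Delta_{\tau G}-\nabla\operatorname{div})X\rangle_{T_i(G)}-2\langle\nabla_{\tau G}X,\nabla_{\tau G}Y\rangle_{\mathcal{T}^2_i(G)}.$$ Then for all $X,Y\in\mathcal{X}(G)$, $$\sum_{i\in V_G}B(X,Y)(i)=-\langle X,(\Delta_{\tau G}+\nabla\operatorname{div})Y\rangle_{\mathcal{X}(G)}.$$
   Context: Let $G=(V_G,E_G)$ be a finite simple graph. For $\{i,j\}\in E_G$, $ij$ denotes the edge directed from $i$ to $j$, i.e. the ordered pair $(i,j)$. Let $V_{tG}=V_{\tau G}=\{ij\mid\{i,j\}\in E_G\}$ be the set of directed edges; for $u=ij$ put $\pi(u)=i$, $\pi_+(u)=j$, $\overline{u}=ji$. The complete tangent graph $\tau G$ is the finite simple graph with vertex set $V_{tG}$ in which $\{u,v\}$ is an edge iff $\{\pi(u),\pi(v)\}\in E_G$. The space $\mathcal{X}(G)$ of vector fields is identified with real functions $X\colon V_{tG}\to\mathbb{R}$ (coefficients), with $\langle X,Y\rangle_{T_i(G)}=\sum_{\pi(u)=i}X(u)Y(u)$ and $\langle X,Y\rangle_{\mathcal{X}(G)}=\sum_{u\in V_{tG}}X(u)Y(u)$. For $\phi\colon V_G\to\mathbb{R}$, $\nabla\phi(u)=\phi(\pi_+(u))-\phi(\pi(u))$;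 for $X\in\mathcal{X}(G)$, $\operatorname{div}X(i)=\sum_{\pi(u)=i}(X(\overline{u})-X(u))$. Since $\tau G$ is a finite simple graph, it has its own directed edges $V_{t\tau G}$, with base point $\pi(a)\in V_{tG}$ and end point $\pi_+(a)\in V_{tG}$ for $a\in V_{t\tau G}$, and its own gradient and Laplacian acting on functions on $V_{tG}$, i.e. on $\mathcal{X}(G)$: $\nabla_{\tau G}X(a)=X(\pi_+(a))-X(\pi(a))$ and $\Delta_{\tau G}X(u)=-2\sum_{a\in V_{t\tau G},\,\pi(a)=u}\nabla_{\tau G}X(a)$. With $\pi^2(a)=\pi(\pi(a))\in V_G$, $\langle\nabla_{\tau G}X,\nabla_{\tau G}Y\rangle_{\mathcal{T}^2_i(G)}=\sum_{a\in V_{t\tau G},\,\pi^2(a)=i}\nabla_{\tau G}X(a)\,\nabla_{\tau G}Y(a)$. *)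

(* Defs.v *)
From mathcomp Require Import all_boot all_order all_algebra.
From mathcomp Require Import reals.

Set Implicit Arguments.
Unset Strict Implicit.
Unset Printing Implicit Defensive.

Import GRing.Theory.
Local Open Scope ring_scope.

Record sgraph := SGraph {
  vertex :> finType;
  adj : rel vertex;
  adj_sym : symmetric adj;
  adj_irr : irreflexive adj
}.

Definition dedge (G : sgraph) : finType := {p : G * G | adj p.1 p.2}.

Section DirectedEdges.
Variable G : sgraph.
Implicit Types u v : dedge G.

Definition src u : G := (val u).1.
Definition tgt u : G := (val u).2.

Fact flip_subproof u : adj (tgt u, src u).1 (tgt u, src u).2.
Proof. by rewrite /= adj_sym; exact: valP u. Qed.
Definition flip u : dedge G := exist _ (tgt u, src u) (flip_subproof u).

Definition tangent_adj : rel (dedge G) := fun u v => adj (src u) (src v).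
Fact tangent_sym : symmetric tangent_adj.
Proof. by move=> u v; exact: adj_sym. Qed.
Fact tangent_irr : irreflexive tangent_adj.
Proof. by move=> u; exact: adj_irr. Qed.
(* The complete tangent graph. Its vertex type is [dedge G] by conversion, so
   that functions on its vertices are vector fields on [G]. *)
Definition tangent : sgraph := SGraph tangent_sym tangent_irr.

End DirectedEdges.

Section Calculus.
Variables (R : realType) (G : sgraph).

Definition grad (phi : {ffun G -> R}) : {ffun dedge G -> R} :=
  [ffun u => phi (tgt u) - phi (src u)].

Definition div (X : {ffun dedge G -> R}) : {ffun G -> R} :=
  [ffun i => \sum_(u : dedge G | src u == i) (X (flip u) - X u)].

(* The sign makes it nonnegative; it equals [div (grad phi)]. *)
Definition lap (phi : {ffun G -> R}) : {ffun G -> R} :=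
  [ffun i => - 2 * \sum_(u : dedge G | src u == i) grad phi u].

Definition dot_at (i : G) (X Y : {ffun dedge G -> R}) : R :=
  \sum_(u : dedge G | src u == i) X u * Y u.

Definition dot (X Y : {ffun dedge G -> R}) : R :=
  \sum_(u : dedge G) X u * Y u.

End Calculus.

Section TangentCalculus.
Variables (R : realType) (G : sgraph).
Implicit Types X Y : {ffun dedge G -> R}.

Definition tgrad X : {ffun dedge (tangent G) -> R} := @grad R (tangent G) X.

Definition tlap X : {ffun dedge G -> R} := @lap R (tangent G) X.

Definition src2 (a : dedge (tangent G)) : G :=
  @src G (@src (tangent G) a).

Definition dot2_at (i : G) (S T : {ffun dedge (tangent G) -> R}) : R :=
  \sum_(a : dedge (tangent G) | src2 a == i) S a * T a.

Definition Bform X Y (i : G) : R :=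
  2^-1 * dot_at i X (tlap Y - grad (div Y))
  + 2^-1 * dot_at i Y (tlap X - grad (div X))
  - 2 * dot2_at i (tgrad X) (tgrad Y).

End TangentCalculus.

(* Main.v *)
Require Import Defs.
From mathcomp Require Import all_boot all_order all_algebra.
From mathcomp Require Import reals.
From mathcomp Require Import ring.
Import GRing.Theory.
Local Open Scope ring_scope.

(** On any finite simple graph, reversing edges shows that [div] is the
    adjoint of [grad] ([dot_grad]); moreover [lap] is [div] after [grad]
    ([lapE]). Applying adjointness on [G] gives
    [dot X (grad (div Y)) = \sum_i div X i * div Y i], and applying it on the
    tangent graph gives [dot X (tlap Y) = dot (tgrad X) (tgrad Y)]
    ([dot_tlap]); both right-hand sides are symmetric in [X] and [Y]. Summing
    the local pairings over the vertices of [G] yields the global ones, so the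
    total of [Bform] is [1/2 + 1/2 - 2 = -1] times [dot X (tlap Y)] plus
    [- 1/2 - 1/2 = -1] times [dot X (grad (div Y))]. *)

Lemma flipK (G : sgraph) : involutive (@flip G).
Proof. by move=> u; apply/val_inj; case: u => -[]. Qed.

Lemma sum_flip (R : realType) (G : sgraph) (F : dedge G -> R) :
  \sum_(u : dedge G) F (flip u) = \sum_(u : dedge G) F u.
Proof. by rewrite [RHS](reindex_inj (inv_inj (@flipK G))). Qed.

(** Discrete integration by parts. With these sign conventions [div] is the
    adjoint of [grad] with no minus sign. *)
Lemma dot_grad (R : realType) (G : sgraph)
    (X : {ffun dedge G -> R}) (phi : {ffun G -> R}) :
  dot X (grad phi) = \sum_(i : G) div X i * phi i.
Proof.
have -> : \sum_(i : G) div X i * phi i =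
    \sum_(u : dedge G) (X (flip u) - X u) * phi (src u).
  rewrite [RHS](partition_big (@src G) predT) //=; apply: eq_bigr => i _.
  by rewrite ffunE mulr_suml; apply: eq_bigr => u /eqP ->.
under [RHS]eq_bigr => u _ do rewrite mulrBl.
rewrite sumrB -(sum_flip _ _ (fun u => X (flip u) * phi (src u))) -sumrB.
by apply: eq_bigr => u _; rewrite ffunE flipK -mulrBr.
Qed.

Lemma lapE (R : realType) (G : sgraph) (phi : {ffun G -> R}) :
  lap phi = div (grad phi).
Proof.
apply/ffunP => i; rewrite !ffunE mulr_sumr; apply: eq_bigr => u _.
by rewrite !ffunE /src /tgt /=; ring.
Qed.

Lemma dotC (R : realType) (G : sgraph) (X Y : {ffun dedge G -> R}) :
  dot X Y = dot Y X.
Proof. by apply: eq_bigr => u _; rewrite mulrC. Qed.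

(** Green's identity on the tangent graph, whose vertices are the directed
    edges of [G]. *)
Lemma dot_tlap (R : realType) (G : sgraph) (X Y : {ffun dedge G -> R}) :
  dot X (tlap Y) = dot (tgrad X) (tgrad Y).
Proof.
rewrite [RHS]dotC /tgrad dot_grad -lapE /dot.
by apply: eq_bigr => u _; rewrite mulrC.
Qed.

Lemma dot_tlapC (R : realType) (G : sgraph) (X Y : {ffun dedge G -> R}) :
  dot X (tlap Y) = dot Y (tlap X).
Proof. by rewrite dot_tlap dotC -dot_tlap. Qed.

Lemma dot_grad_divC (R : realType) (G : sgraph) (X Y : {ffun dedge G -> R}) :
  dot X (grad (div Y)) = dot Y (grad (div X)).
Proof. by rewrite !dot_grad; apply: eq_bigr => i _; rewrite mulrC. Qed.

Lemma sum_dot_at (R : realType) (G : sgraph) (X Y : {ffun dedge G -> R}) :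
  \sum_(i : G) dot_at i X Y = dot X Y.
Proof. by rewrite /dot (partition_big (@src G) predT). Qed.

Lemma sum_dot2_at (R : realType) (G : sgraph)
    (S T : {ffun dedge (tangent G) -> R}) :
  \sum_(i : G) dot2_at i S T = dot S T.
Proof. by rewrite /dot (partition_big (@src2 G) predT). Qed.

Lemma dotDr (R : realType) (G : sgraph) (X Y Z : {ffun dedge G -> R}) :
  dot X (Y + Z) = dot X Y + dot X Z.
Proof.
by rewrite -big_split; apply: eq_bigr => u _; rewrite ffunE mulrDr.
Qed.

Lemma dotBr (R : realType) (G : sgraph) (X Y Z : {ffun dedge G -> R}) :
  dot X (Y - Z) = dot X Y - dot X Z.
Proof.
by rewrite -sumrB; apply: eq_bigr => u _; rewrite !ffunE mulrBr.
Qed.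

Theorem mainTheorem2 (R : realType) (G : sgraph) (X Y : {ffun dedge G -> R}) :
  \sum_(i : G) Bform X Y i = - dot X (tlap Y + grad (div Y)).
Proof.
rewrite sumrB big_split -!mulr_sumr /= !sum_dot_at sum_dot2_at.
rewrite !dotBr dotDr (dot_tlapC _ _ Y) (dot_grad_divC _ _ Y) -dot_tlap.
by field.
Qed.
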